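(* For every $n\ge 1$, the projector $f_n\in VTL_n(d)$ is given explicitly by $$f_n=\sum_{l=0}^{\lfloor n/2\rfloor}\frac{(-2)^{l}\,l!}{n!\prod_{i=1}^{l}(d+2n-2-2i)}\,[n-2l]_n,$$ where $[k]_n$ denotes the sum of all $k$-elements of $VTL_n(d)$, i.e. of all diagrams with exactly $k$ through strands.
   Context: Let $d$ be an indeterminate and $K=\mathbb{C}(d)$. The virtual Temperley-Lieb algebra $VTL_n(d)$ is the unital associative $K$-algebra (isomorphic to the Brauer algebra with parameter $d$) with $K$-basis the set of all $(2n-1)!!$ diagrams (''connection elements''), i.e. perfect matchings of $2n$ points consisting of $n$ top points $1,\dots,n$ and $n$ bottom points $1,\dots,n$. The product $XY$ of diagrams is obtained by stacking $X$ above $Y$, identifying the bottom points of $X$ with the top points of $Y$, replacing each closed loop formed by a factor $d$. The identity $1_n$ joins top $j$ to bottom $j$ for all $j$. For $1\le i\le n-1$: $e_i$ joins top $i$ to top $i+1$, bottom $i$ to bottom $i+1$, and top $j$ to bottom $j$ for $j\ne i,i+1$; $v_i$ joins top $i$ to bottom $i+1$, top $i+1$ to bottom $i$, and top $j$ to bottom $j$ for $j\ne i,i+1$. $VTL_{n-1}(d)$ is regarded as a subalgebra of $VTL_n(d)$ by adding a vertical strand joining top $n$ to bottom $n$. A through strand of a diagram is an arc joining a top point to a bottom point. For each $n\ge1$, the projector $f_n\in VTL_n(d)$ is the unique non-zero element with $f_n^2=f_n$, $f_ne_i=e_if_n=0$ and $f_nv_i=v_if_n=f_n$ for all $1\le i\le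 n-1$. Equivalently, $f_1=1_1$ and, for $n\ge2$, $f_n=x_{n-1}f_{n-1}+y_{n-1}f_{n-1}e_{n-1}f_{n-1}+z_{n-1}f_{n-1}v_{n-1}f_{n-1}$, where $x_i=\frac{1}{i+1}$, $y_i=-\frac{2i}{(i+1)(d+2i-2)}$, $z_i=\frac{i}{i+1}$. *)

(* Defs.v *)
From HB Require Import structures.
From mathcomp Require Import all_boot all_order all_fingroup all_algebra.
From mathcomp Require Import fraction complex reals.

Set Implicit Arguments.
Unset Strict Implicit.
Unset Printing Implicit Defensive.

Import Order.TTheory GRing.Theory Num.Theory.
Local Open Scope ring_scope.

Section TwoInvolutions.

Variables (T : finType) (a b : T -> T).

Definition link : rel T := [rel u v | (v == a u) || (v == b u)].
Definition endpoint : pred T := [pred u | (a u == u) || (b u == u)].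

End TwoInvolutions.

(* A component of a graph of maximal degree 2 is a path or a cycle, so an
   endpoint is joined to exactly one other endpoint. *)
Section Endpoints.

Variable T : finType.
Implicit Types (a b : T -> T) (p q r : T).

Lemma endpoint_unique_half a b (aK : involutive a) (bK : involutive b)
    (ab : forall u, ~~ ((a u == u) && (b u == u))) p (bp : b p = p) :
  exists q, [/\ q != p, endpoint a b q, connect (link a b) p q &
    forall r, endpoint a b r -> connect (link a b) p r -> r != p -> r = q].
Proof.
pose f u := a (b u); pose g u := b (a u).
have fg k u : iter k f (iter k g u) = u.
  elim: k u => [//|k IH] u; rewrite iterSr [iter k.+1 g u]iterS.
  by rewrite {2}/f /g bK aK IH.
have fI : injective f by move=> u v /(inv_inj aK)/(inv_inj bK).
have fkI k : injective (iter k f).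
  by elim: k => [|k IH] u v //= /fI/IH.
have bE k : b (iter k f p) = iter k g p.
  by elim: k => [//|k IH]; rewrite !iterS -IH /f /g.
have aE k : a (iter k.+1 f p) = iter k g p by rewrite iterS /f aK bE.
set m := fingraph.order f p.
have m_gt0 : (0 < m)%N by exact: fingraph.order_gt0.
have fm : iter m f p = p by rewrite iter_order.
have small k : (k < m)%N -> iter k f p = p -> k = 0%N.
  by move=> km kp; rewrite -(findex_iter km) kp findex0.
have period N : (N < m.*2)%N -> iter N f p = p -> N = 0%N \/ N = m.
  case: (ltnP N m) => [Nm _ /(small _ Nm)|mN N2 Np]; first by left.
  right; have Nr : (N - m < m)%N by rewrite ltn_subLR // addnn.
  have /(small _ Nr) : iter (N - m) f p = p.
    by rewrite -[RHS]Np -{2}(subnK mN) iterD fm.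
  by move/eqP; rewrite subn_eq0 => le; apply/eqP; rewrite eqn_leq le.
have gin k : fconnect f p (iter k g p).
  by rewrite fconnect_sym // -{2}(fg k p) fconnect_iter.
have ap : a p != p by move: (ab p); rewrite bp eqxx andbT.
have orb r : connect (link a b) p r -> fconnect f p r.
  case/connectP=> s; elim/last_ind: s r => [|s x IH] r /=.
    by move=> _ ->; exact: connect0.
  rewrite rcons_path last_rcons => /andP[ps /= lx] ->{r}.
  have /iter_findex := IH _ ps erefl; move: (findex _ _ _) => k e.
  case/orP: lx => /eqP ->; rewrite -e; last by rewrite bE.
  case: k {e} => [|k]; last by rewrite aE.
  by rewrite /= -{2}bp; exact: fconnect1.
have orbV k : connect (link a b) p (iter k f p).
  elim: k => [|k IH]; first exact: connect0.
  apply: connect_trans IH _; rewrite iterS.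
  apply: (@connect_trans _ _ (b (iter k f p))); apply: connect1.
    by rewrite /link /= eqxx orbT.
  by rewrite /link /= eqxx.
have fixb k : (k < m)%N -> b (iter k f p) = iter k f p -> k = 0%N \/ k.*2 = m.
  move=> km; rewrite bE => e.
  have := fg k p; rewrite e -iterD addnn => /period; rewrite ltn_double.
  by case/(_ km) => [/eqP|]; [rewrite double_eq0 => /eqP; left|right].
have fixa k : (k < m)%N -> a (iter k f p) = iter k f p -> k.*2.-1 = m.
  case: k => [_ /eqP|k km]; first by rewrite /= (negPf ap).
  rewrite aE => e; have := fg k p; rewrite e -iterD addnS addnn => e'.
  case: (period _ _ e') => //; rewrite -ltn_double in km.
  by apply: leq_trans km; rewrite doubleS.
have uniq_end r : endpoint a b r -> connect (link a b) p r -> r != p ->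
    r = iter (uphalf m) f p.
  move=> er /orb /[dup] /findex_max; set k := findex f p r => km.
  move/iter_findex; rewrite -/k => ek; rewrite -ek in er *.
  case/orP: er => /eqP.
    move/(fixa _ km); case: k {ek} km => [|k] km.
      by move=> m0; rewrite -m0 in m_gt0.
    by rewrite doubleS /= => <- _; rewrite /= doubleK.
  case/(fixb _ km) => [->|<- _]; first by rewrite eqxx.
  by rewrite uphalf_double.
have mE := odd_double_half m; set h := m./2 in mE.
have qE : uphalf m = (odd m + h)%N by exact: uphalf_half.
have fixq : if odd m then a (iter (uphalf m) f p) = iter (uphalf m) f p
            else b (iter (uphalf m) f p) = iter (uphalf m) f p.
  rewrite qE; case: (odd m) mE => mE; apply: (fkI h).
    by rewrite add1n aE fg -iterD addnS addnn -add1n mE fm.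
  by rewrite add0n bE fg -iterD addnn -[h.*2]add0n mE fm.
exists (iter (uphalf m) f p); split; last exact: uniq_end; last exact: orbV.
  case: (odd m) fixq qE mE => [aq _ _|_ qE mE].
    by apply: contra ap => /eqP e; rewrite -{1}e aq e.
  have h_gt0 : (0 < h)%N by rewrite -double_gt0 -[h.*2]add0n mE.
  have hm : (h < m)%N by rewrite -mE add0n -addnn -{1}[h]add0n ltn_add2r.
  by apply/eqP; rewrite qE add0n => /(small _ hm) h0; rewrite h0 in h_gt0.
by apply/orP; case: (odd m) fixq => ->; [left|right].
Qed.

Lemma endpoint_unique a b (aK : involutive a) (bK : involutive b)
    (ab : forall u, ~~ ((a u == u) && (b u == u))) p (ep : endpoint a b p) :
  exists q, [/\ q != p, endpoint a b q, connect (link a b) p q &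
    forall r, endpoint a b r -> connect (link a b) p r -> r != p -> r = q].
Proof.
case/orP: ep => /eqP hp; last exact: endpoint_unique_half.
have ba u : ~~ ((b u == u) && (a u == u)) by rewrite andbC.
have cE : connect (link b a) =2 connect (link a b).
  by apply: eq_connect => u v; rewrite /link /= orbC.
have eE u : endpoint b a u = endpoint a b u by rewrite /endpoint /= orbC.
have [q [qp eq cq uq]] := endpoint_unique_half bK aK ba hp.
exists q; split=> //; rewrite -?eE -?cE //.
by move=> r; rewrite -eE -cE; exact: uq.
Qed.

End Endpoints.

(* [inl i] is the top point i, [inr i] is the bottom point i. *)
Definition point (n : nat) := ('I_n + 'I_n)%type.

Definition is_matching (n : nat) (f : {ffun point n -> point n}) : bool :=
  [forall p, (f p != p) && (f (f p) == p)].

(* A perfect matching, encoded by the fixed-point-free involution that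
   exchanges the two ends of each arc. *)
Record diagram (n : nat) := Diagram {
  mate :> {ffun point n -> point n};
  _ : is_matching mate }.

HB.instance Definition _ n := [isSub for @mate n].
HB.instance Definition _ n := [Finite of diagram n by <:].

Lemma mate_neq n (X : diagram n) p : X p != p.
Proof. by case: X => f /= /forallP/(_ p)/andP[]. Qed.

Lemma mateK n (X : diagram n) : involutive X.
Proof. by case: X => f /= h p; have /forallP/(_ p)/andP[_ /eqP] := h. Qed.

(* The points of X stacked above Y: [inl (inl i)] is a top point of X,
   [inl (inr i)] a bottom point of X identified with a top point of Y, and
   [inr i] a bottom point of Y. *)
Definition stack_point (n : nat) := (point n + 'I_n)%type.

Definition lower (n : nat) (p : point n) : stack_point n :=
  match p with inl i => inl (inr i) | inr i => inr i end.

Definition outer (n : nat) (p : point n) : stack_point n :=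
  match p with inl i => inl (inl i) | inr i => inr i end.

Definition upper_mate (n : nat) (X : diagram n) (u : stack_point n) :
    stack_point n :=
  match u with inl p => inl (X p) | inr _ => u end.

Definition lower_mate (n : nat) (Y : diagram n) (u : stack_point n) :
    stack_point n :=
  match u with
  | inl (inl _) => u
  | inl (inr i) => lower (Y (inl i))
  | inr i => lower (Y (inr i))
  end.

Definition stack (n : nat) (X Y : diagram n) : rel (stack_point n) :=
  link (upper_mate X) (lower_mate Y).

Lemma outer_inj n : injective (@outer n).
Proof. by move=> [i|i] [j|j] //= [->]. Qed.

Lemma lower_inj n : injective (@lower n).
Proof. by move=> [i|i] [j|j] //= [->]. Qed.

Lemma endpoint_stack n (X Y : diagram n) u :
  endpoint (upper_mate X) (lower_mate Y) u = (u \in codom (@outer n)).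
Proof.
have ot p : outer p \in codom (@outer n) by exact: codom_f.
have ln := inj_eq (@lower_inj n).
rewrite /endpoint; case: u => [[i|i]|i] /=.
- by rewrite eqxx orbT (ot (inl i)).
- rewrite (ln (Y (inl i)) (inl i)) (negPf (mate_neq Y _)) orbF.
  rewrite [_ == _](negPf (mate_neq X (inr i))); symmetry; apply/negbTE.
  by apply/codomP => -[[]].
- by rewrite eqxx (ot (inr i)).
Qed.

Lemma outer_unique n (X Y : diagram n) (p : point n) :
  exists q, [/\ q != p, connect (stack X Y) (outer p) (outer q) &
    forall r, connect (stack X Y) (outer p) (outer r) -> r != p -> r = q].
Proof.
have aK : involutive (upper_mate X) by move=> [q|i] //=; rewrite mateK.
have bK : involutive (lower_mate Y).
  have lK q : lower_mate Y (lower q) = lower (Y q) by case: q.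
  by move=> [[i|i]|i] //=; rewrite lK mateK.
have ln := inj_eq (@lower_inj n).
have ab u : ~~ ((upper_mate X u == u) && (lower_mate Y u == u)).
  case: u => [q|i] /=; first by rewrite [_ == _](negPf (mate_neq X q)).
  by rewrite eqxx (ln (Y (inr i)) (inr i)) mate_neq.
have ep r : endpoint (upper_mate X) (lower_mate Y) (outer r).
  by rewrite endpoint_stack codom_f.
have [v [vp + cv uv]] := endpoint_unique aK bK ab (ep p).
rewrite endpoint_stack => /codomP[q eq].
rewrite {}eq in vp cv uv; exists q; split=> //.
  by apply: contraNneq vp => ->.
move=> r cr rp; apply: outer_inj; apply: uv => //.
by apply: contraNneq rp => /outer_inj ->.
Qed.

Definition compose_mate (n : nat) (X Y : diagram n) :
    {ffun point n -> point n} :=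
  [ffun p => odflt p
    [pick q | (q != p) && connect (stack X Y) (outer p) (outer q)]].

Lemma compose_mateP n (X Y : diagram n) p q :
  reflect (q != p /\ connect (stack X Y) (outer p) (outer q))
          (compose_mate X Y p == q).
Proof.
apply: (iffP eqP); have [q0 [q0p cq0 uq0]] := outer_unique X Y p;
  rewrite ffunE; case: pickP => [r /andP[rp cr]|/(_ q0)];
  rewrite ?q0p ?cq0 //=; first by move=> <-.
by case=> qp cq; rewrite (uq0 _ cr rp) (uq0 _ cq qp).
Qed.

Lemma stack_connect_sym n (X Y : diagram n) : connect_sym (stack X Y).
Proof.
have aK : involutive (upper_mate X) by move=> [q|i] //=; rewrite mateK.
have bK : involutive (lower_mate Y).
  have lK q : lower_mate Y (lower q) = lower (Y q) by case: q.
  by move=> [[i|i]|i] //=; rewrite lK mateK.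
apply: sym_connect_sym => u v; rewrite /stack /link /=.
by rewrite -(inv_eq aK v u) -(inv_eq bK v u) ![_ == u]eq_sym.
Qed.

Lemma compose_is_matching n (X Y : diagram n) :
  is_matching (compose_mate X Y).
Proof.
apply/forallP => p; have /compose_mateP[qp cq] := eqxx (compose_mate X Y p).
rewrite qp; apply/compose_mateP; rewrite eq_sym; split=> //.
by rewrite stack_connect_sym.
Qed.

Definition compose (n : nat) (X Y : diagram n) : diagram n :=
  Diagram (compose_is_matching X Y).

(* The closed loops are the components that meet no outer point. *)
Definition loops (n : nat) (X Y : diagram n) : nat :=
  n_comp (stack X Y)
    [pred u | [forall p : point n, ~~ connect (stack X Y) u (outer p)]].

(* The number of through strands. *)
Definition through (n : nat) (X : diagram n) : nat :=
  #|[set i : 'I_n | if X (inl i) is inr _ then true else false]|.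

(* Numbering from 0: [i : 'I_n.-1] indexes the generators [e_(i+1)] and
   [v_(i+1)], acting on the strands of positions [i] and [i+1]. *)
Section Generators.

Variables (n : nat) (i : 'I_n.-1).

Definition here : 'I_n := widen_ord (leq_pred n) i.

Lemma next_subproof : (i.+1 < n)%N.
Proof. by rewrite -ltn_predRL. Qed.

Definition next : 'I_n := Ordinal next_subproof.

Lemma here_neq_next : here != next.
Proof. by rewrite -val_eqE /= neq_ltn ltnSn. Qed.

Definition swap : 'I_n -> 'I_n := tperm here next.

Definition e_mate : {ffun point n -> point n} :=
  [ffun p => match p with
    | inl k => if k \in [:: here; next] then inl (swap k) else inr k
    | inr k => if k \in [:: here; next] then inr (swap k) else inl k
    end].

Definition v_mate : {ffun point n -> point n} :=
  [ffun p => match p with inl k => inr (swap k) | inr k => inl (swap k) end].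

Lemma e_is_matching : is_matching e_mate.
Proof.
have hn := here_neq_next; have nh : next != here by rewrite eq_sym.
have sw k : k \in [:: here; next] ->
    [/\ swap k != k, swap k \in [:: here; next] & swap (swap k) = k].
  rewrite /swap !inE => /orP[] /eqP ->; rewrite ?(tpermL, tpermR) eqxx ?orbT.
    by split.
  by split.
apply/forallP => -[k|k]; rewrite !ffunE;
  case: ifP => hk; rewrite ?hk ?eqxx //; have [sk -> ->] := sw _ hk;
  rewrite eqxx andbT; by apply: contraNneq sk => -[->].
Qed.

Lemma v_is_matching : is_matching v_mate.
Proof. by apply/forallP => -[k|k]; rewrite !ffunE /= /swap tpermK. Qed.

Definition e_diagram : diagram n := Diagram e_is_matching.
Definition v_diagram : diagram n := Diagram v_is_matching.

End Generators.

Section Algebra.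

Variables (K : fieldType) (d : K) (n : nat).

(* The coordinates in the basis of diagrams; [K^o] is [K] as a [K]-module. *)
Definition VTL := {ffun diagram n -> K^o}.

Definition basis (X : diagram n) : VTL := [ffun Z => (Z == X)%:R].

Definition vmul (a b : VTL) : VTL :=
  \sum_X \sum_Y (a X * b Y * d ^+ loops X Y) *: basis (compose X Y).

Definition e_ (i : 'I_n.-1) : VTL := basis (e_diagram i).
Definition v_ (i : 'I_n.-1) : VTL := basis (v_diagram i).

Definition is_projector (f : VTL) : Prop :=
  [/\ f != 0, vmul f f = f &
   forall i : 'I_n.-1,
     [/\ vmul f (e_ i) = 0, vmul (e_ i) f = 0,
         vmul f (v_ i) = f & vmul (v_ i) f = f]].

Definition k_elements_sum (k : nat) : VTL :=
  \sum_(X : diagram n | through X == k) basis X.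

End Algebra.

Definition rational_functions (R : realType) : fieldType :=
  {fraction {poly R[i]}}.

Definition indeterminate (R : realType) : rational_functions R :=
  tofrac ('X : {poly R[i]}).

(* Main.v *)
Require Import Defs.
From HB Require Import structures.
From mathcomp Require Import all_boot all_order all_fingroup all_algebra.
From mathcomp Require Import fraction complex reals ring.
Set Implicit Arguments.
Unset Strict Implicit.
Unset Printing Implicit Defensive.
Import GRing.Theory.
Local Open Scope ring_scope.

(* Let eps f be the sum of the coefficients of f at the permutation diagrams,
   and call f left absorbing if X f = f for every permutation diagram X and
   X f = 0 for every other diagram X.  A diagram that is not a permutation has
   an arc i - j at its bottom, so X f only involves the sums of coefficients
   of f over the diagrams that agree once their top points i and j are capped
   off.  Hence f is left absorbing as soon as its coefficients are invariant
   under permutation of the top points and all these capped sums vanish.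
   - If v_k f = f and e_k f = 0 for all k, this holds: the adjacent
     transpositions generate S_n, and the capped sums for (k, k+1) are, up to
     powers of d, coefficients of e_k f.
   - For the explicit element P, with coefficient a_l at the diagrams with
     n - 2l through strands, the capped sum at such a diagram is
     (d + 2n - 2 - 2l) a_l + 2l a_(l-1) = 0.
   The diagram reversal exchanges left and right.  So for a projector f,
   f = eps(P) f = f P = eps(f) P, and f^2 = f forces eps(f) = 1.  No
   associativity is needed. *)

Lemma connect_homo (T T' : finType) (e : rel T) (e' : rel T') (h : T -> T') :
  (forall u v, e u v -> connect e' (h u) (h v)) ->
  forall u v, connect e u v -> connect e' (h u) (h v).
Proof.
move=> eh u v /connectP[s + ->]; elim: s u => [|w s IH] u /=.
  by move=> _; exact: connect0.
by move=> /andP[/eh uw /IH]; exact: connect_trans.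
Qed.

Section Relabel.

Variable n : nat.
Implicit Types (X Y Z : diagram n) (p q : point n) (s t : {perm point n}).

Lemma diagramP X Y : X =1 Y -> X = Y.
Proof. by move=> XY; apply/val_inj/ffunP. Qed.

Lemma mate_eq X p q : (X p == q) = (p == X q).
Proof. exact: (inv_eq (mateK X)). Qed.

Lemma relabel_subproof s X : is_matching [ffun p => (s^-1)%g (X (s p))].
Proof.
apply/forallP => p; rewrite !ffunE permKV mateK permK eqxx andbT.
by rewrite -(inj_eq (@perm_inj _ s)) permKV mate_neq.
Qed.

Definition relabel s X := Diagram (relabel_subproof s X).

Lemma relabelE s X p : relabel s X p = (s^-1)%g (X (s p)).
Proof. by rewrite ffunE. Qed.

Lemma relabelM s t X : relabel (s * t)%g X = relabel s (relabel t X).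
Proof. by apply: diagramP => p; rewrite !relabelE invMg !permM. Qed.

Lemma relabel1 X : relabel 1 X = X.
Proof. by apply: diagramP => p; rewrite relabelE invg1 !perm1. Qed.

Section Exchange.

Variables (X : diagram n) (p q r : point n).
Hypotheses (Xpq : X p = q) (rp : r != p) (rq : r != q).

Lemma exchange_fst : relabel (tperm q r) X p = r.
Proof.
have pq : q != p by rewrite -Xpq mate_neq.
by rewrite relabelE tpermV (tpermD (z := p)) ?Xpq ?tpermL.
Qed.

Lemma exchange_snd : relabel (tperm q r) X q = X r.
Proof.
rewrite relabelE tpermV tpermL tpermD // eq_sym ?mate_neq //.
by rewrite mate_eq -Xpq mateK.
Qed.

Lemma exchangeD u : u != p -> u != q -> u != r -> u != X r ->
  relabel (tperm q r) X u = X u.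
Proof.
move=> up uq ur uXr; rewrite relabelE tpermV (tpermD (z := u)) 1?eq_sym //.
by rewrite tpermD // eq_sym mate_eq // -Xpq mateK.
Qed.

End Exchange.

Lemma relabel_tpermK p q : involutive (relabel (tperm p q)).
Proof. by move=> X; rewrite -relabelM tperm2 relabel1. Qed.

End Relabel.

Section Stack.

Variable n : nat.
Implicit Types (X Y Z : diagram n) (p q : point n).

Lemma lower_mate_lower Y p : lower_mate Y (lower p) = lower (Y p).
Proof. by case: p. Qed.

Lemma stack_upper X Y p : stack X Y (inl p) (inl (X p)).
Proof. by rewrite /stack /link /= eqxx. Qed.

Lemma stack_lower X Y p : stack X Y (lower p) (lower (Y p)).
Proof. by rewrite /stack /link /= lower_mate_lower eqxx orbT. Qed.

Lemma stackP X Y (P : stack_point n -> stack_point n -> Prop) :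
  (forall u, P u u) -> (forall p, P (inl p) (inl (X p))) ->
  (forall p, P (lower p) (lower (Y p))) ->
  forall u v, stack X Y u v -> P u v.
Proof.
move=> P0 PX PY u v /orP[/eqP->|/eqP->]; first by case: u.
by case: u => [[i|i]|i] //; [exact: (PY (inl i)) | exact: (PY (inr i))].
Qed.

Lemma compose_connect X Y p q : q != p ->
  connect (stack X Y) (outer p) (outer q) -> compose X Y p = q.
Proof. by move=> qp c; apply/eqP/compose_mateP. Qed.

Lemma connect_compose X Y p :
  connect (stack X Y) (outer p) (outer (compose X Y p)).
Proof. by have /compose_mateP[] := eqxx (compose_mate X Y p). Qed.

Definition closed_part X Y : pred (stack_point n) :=
  [pred u | [forall p : point n, ~~ connect (stack X Y) u (outer p)]].

Lemma loopsE X Y : loops X Y = n_comp (stack X Y) (closed_part X Y).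
Proof. by []. Qed.

Lemma closed_part_closed X Y : closed (stack X Y) (closed_part X Y).
Proof.
apply: intro_closed => [|u v uv /forallP cu]; first exact: stack_connect_sym.
apply/forallP => p; apply: contra (cu p); apply: connect_trans.
exact: connect1.
Qed.

Lemma loops_eq0 X Y :
  (forall u, exists p, connect (stack X Y) u (outer p)) -> loops X Y = 0%N.
Proof.
move=> h; apply: eq_card0 => u; rewrite !inE; apply/negbTE/nandP; right.
have [p up] := h u.
by apply/negP => /forallP/(_ p); rewrite up.
Qed.

End Stack.

(* The arc [i - j] at the bottom of [X] and the arc [i - j] at the top of [Y]
   close a loop; exchanging [j] with [p] in [Y] opens this loop into the arc
   of [p]. *)
Section OpenLoop.

Variables (n : nat) (X Y : diagram n) (i j : 'I_n) (p : point n).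
Hypotheses (Xij : X (inr i) = inr j) (Yij : Y (inl i) = inl j).
Hypotheses (pi : p != inl i) (pj : p != inl j).

Let Z := relabel (tperm (inl j) p) Y.
Let q := Y p.
Let Mi : stack_point n := lower (inl i).
Let Mj : stack_point n := lower (inl j).

Let ij : i != j.
Proof. by have := mate_neq Y (inl i); rewrite Yij eq_sym. Qed.

Let Yji : Y (inl j) = inl i. Proof. by rewrite -Yij mateK. Qed.

Let qi : q != inl i.
Proof. by rewrite mate_eq Yij. Qed.
Let qj : q != inl j.
Proof. by rewrite mate_eq Yji. Qed.

Let Zi : Z (inl i) = p. Proof. exact: exchange_fst. Qed.
Let Zp : Z p = inl i. Proof. by rewrite -Zi mateK. Qed.
Let Zj : Z (inl j) = q. Proof. exact: exchange_snd Yij pi. Qed.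
Let Zq : Z q = inl j. Proof. by rewrite -Zj mateK. Qed.
Let ZD (r : point n) : r != inl i -> r != inl j -> r != p -> r != q ->
  Z r = Y r.
Proof. exact: exchangeD Yij r. Qed.

Let phi (u : stack_point n) : stack_point n :=
  if u == Mi then lower p else if u == Mj then lower q else u.

Let low_eq (r r' : point n) : (lower r == lower r') = (r == r').
Proof. exact/inj_eq/lower_inj. Qed.

Let phi_low (r : point n) : phi (lower r) =
  if r == inl i then lower p else if r == inl j then lower q else lower r.
Proof. by rewrite /phi !low_eq. Qed.

Let phi_up (r : point n) : phi (inl r) =
  if r == inr i then lower p else if r == inr j then lower q else inl r.
Proof. by []. Qed.

Let Xji : X (inr j) = inr i. Proof. by rewrite -Xij mateK. Qed.

Let MiMj : connect (stack X Z) Mi Mj.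
Proof. by apply: connect1; rewrite -[Mj]/(inl (inr j)) -Xij stack_upper. Qed.

Let Mip : connect (stack X Z) Mi (lower p).
Proof. by apply: connect1; rewrite -Zi stack_lower. Qed.

Let Mjq : connect (stack X Z) Mj (lower q).
Proof. by apply: connect1; rewrite -Zj stack_lower. Qed.

Let symZ := stack_connect_sym X Z.

Let YZ u v : connect (stack X Y) u v -> connect (stack X Z) u v.
Proof.
apply: (@connect_homo _ _ _ _ id); apply: stackP => [w|r|r].
- exact: connect0.
- by apply: connect1; exact: stack_upper.
have pq : connect (stack X Z) (lower p) (lower q).
  by apply: connect_trans (connect_trans MiMj Mjq); rewrite symZ.
have [->|ri] := eqVneq r (inl i); first by rewrite Yij.
have [->|rj] := eqVneq r (inl j); first by rewrite Yji symZ.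
have [->//|rp] := eqVneq r p.
have [->|rq] := eqVneq r q; first by rewrite /q mateK symZ.
by apply: connect1; rewrite -(ZD ri rj rp rq) stack_lower.
Qed.

Let phiZ u : connect (stack X Z) u (phi u).
Proof.
rewrite /phi; case: eqP => [->//|_]; case: eqP => [->//|_]; exact: connect0.
Qed.

Let phiE u v : connect (stack X Z) u v = connect (stack X Y) (phi u) (phi v).
Proof.
apply/idP/idP => [|/YZ uv]; last first.
  apply: connect_trans (phiZ u) _; apply: connect_trans uv _.
  by rewrite symZ.
move: u v; apply: connect_homo; apply: stackP => [w|r|r].
- exact: connect0.
- have lpq : connect (stack X Y) (lower p) (lower q).
    by apply: connect1; exact: stack_lower.
  rewrite !phi_up; have [->|ri] := eqVneq r (inr i).
    by rewrite Xij ifN ?eqxx //; apply: contraNneq ij => -[->].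
  have [->|rj] := eqVneq r (inr j).
    by rewrite Xji eqxx stack_connect_sym.
  rewrite !mate_eq Xij Xji (negPf ri) (negPf rj).
  by apply: connect1; exact: stack_upper.
rewrite !phi_low.
have [->|ri] := eqVneq r (inl i).
  by rewrite Zi (negPf pi) (negPf pj) connect0.
have [->|rj] := eqVneq r (inl j).
  by rewrite Zj (negPf qi) (negPf qj) connect0.
have [->|rp] := eqVneq r p; first by rewrite Zp eqxx connect0.
have [->|rq] := eqVneq r q.
  by rewrite Zq eqxx ifN ?connect0 // eq_sym; apply: contraNneq ij => -[->].
rewrite ZD // !mate_eq Yij Yji (negPf ri) (negPf rj).
by apply: connect1; exact: stack_lower.
Qed.

Let phi_outer r : phi (outer r) = outer r.
Proof. by case: r. Qed.

Lemma compose_open_loop : compose X Z = compose X Y.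
Proof.
apply: diagramP => r; apply: compose_connect; first exact: mate_neq.
by rewrite phiE !phi_outer connect_compose.
Qed.

Let phi_Mi u : (phi u != Mi) && (phi u != Mj).
Proof.
rewrite /phi; have [_|uMi] := eqVneq u Mi; first by rewrite !low_eq pi pj.
have [_|uMj] := eqVneq u Mj; first by rewrite !low_eq qi qj.
by rewrite uMi.
Qed.

Let MY u : connect (stack X Y) Mi u = (u == Mi) || (u == Mj).
Proof.
apply/idP/idP => [|/orP[]/eqP->]; last 2 first.
- exact: connect0.
- by apply: connect1; rewrite /Mj -Yij stack_lower.
have cl : closed (stack X Y) (pred2 Mi Mj).
  apply: intro_closed; first exact: stack_connect_sym.
  apply: stackP => // r; rewrite !inE.
    rewrite -[Mi]/(inl (inr i)) -[Mj]/(inl (inr j)) !(inj_eq inl_inj).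
    rewrite !mate_eq -Xij mateK.
    by case/orP=> /eqP ->; rewrite ?Xij eqxx ?orbT.
  rewrite !low_eq !mate_eq Yij Yji.
  by case/orP=> /eqP ->; rewrite eqxx ?orbT.
by move=> /(closed_connect cl); rewrite !inE eqxx /= => <-.
Qed.

Lemma loops_open_loop : loops X Y = (loops X Z).+1.
Proof.
have symY := stack_connect_sym X Y.
pose a := [predD closed_part X Y & pred2 Mi Mj].
have clM : closed (stack X Y) (pred2 Mi Mj).
  move=> u v uv; rewrite !inE -!MY.
  by apply: same_connect_r => //; exact: connect1.
have cla : closed (stack X Y) a.
  move=> u v uv; rewrite !inE; congr (~~ _ && _).
    by have := clM u v uv; rewrite !inE.
  exact: (closed_part_closed uv).
have MiL u : u \in pred2 Mi Mj -> u \in closed_part X Y.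
  rewrite !inE -MY => cu; apply/forallP => r; rewrite -(same_connect symY cu).
  by rewrite MY; case: r.
have -> : loops X Y = (1 + n_comp (stack X Y) a)%N.
  rewrite loopsE -(n_comp_connect symY Mi) /n_comp_mem.
  rewrite -(cardID (pred2 Mi Mj)); congr (_ + _)%N; apply: eq_card => u.
    have := MiL u; rewrite !inE -MY.
    by case: (connect _ Mi u) => [->|_]; rewrite ?andbT ?andbF.
  by rewrite !inE; do ! case: (_ == _) => //=; rewrite ?andbF.
have adj : rel_adjunction phi (stack X Y) (stack X Z) a.
  split=> [u|u v _]; last exact: phiE.
  rewrite !inE negb_or => /andP[/andP[ui uj] _]; exists u.
  by rewrite /phi (negPf ui) (negPf uj) connect0.
rewrite (adjunction_n_comp _ symY symZ cla adj) add1n loopsE; congr _.+1.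
apply: eq_n_comp_r => u; rewrite !inE negb_or phi_Mi /=.
by apply: eq_forallb => r; rewrite phiE phi_outer.
Qed.

End OpenLoop.

Section Flip.

Variable n : nat.
Implicit Types (X Y : diagram n) (p : point n).

Definition flip_point p : point n :=
  match p with inl i => inr i | inr i => inl i end.

Lemma flip_pointK : involutive flip_point. Proof. by case. Qed.

Lemma flip_subproof X :
  is_matching [ffun p => flip_point (X (flip_point p))].
Proof.
apply/forallP => p; rewrite !ffunE flip_pointK mateK flip_pointK eqxx andbT.
by rewrite (inv_eq flip_pointK) mate_neq.
Qed.

Definition flip X := Diagram (flip_subproof X).

Lemma flipE X p : flip X p = flip_point (X (flip_point p)).
Proof. by rewrite ffunE. Qed.

Lemma flipK : involutive flip.
Proof. by move=> X; apply: diagramP => p; rewrite !flipE !flip_pointK. Qed.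

Definition flip_stack (u : stack_point n) : stack_point n :=
  match u with
  | inl (inl i) => inr i
  | inl (inr i) => inl (inr i)
  | inr i => inl (inl i)
  end.

Lemma flip_stackK : involutive flip_stack. Proof. by case=> [[]|]. Qed.

Lemma flip_stack_outer p : flip_stack (outer p) = outer (flip_point p).
Proof. by case: p. Qed.

Lemma connect_flip X Y u v :
  connect (stack (flip Y) (flip X)) (flip_stack u) (flip_stack v) =
  connect (stack X Y) u v.
Proof.
have homo X' Y' u' v' : connect (stack X' Y') u' v' ->
    connect (stack (flip Y') (flip X')) (flip_stack u') (flip_stack v').
  have inlE p : flip_stack (inl p) = lower (flip_point p) by case: p.
  have lowE p : flip_stack (lower p) = inl (flip_point p) by case: p.
  apply: connect_homo; apply: stackP => [w|p|p]; first exact: connect0.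
  - have := stack_lower (flip Y') (flip X') (flip_point p).
    by rewrite flipE flip_pointK -!inlE => /connect1.
  have := stack_upper (flip Y') (flip X') (flip_point p).
  by rewrite flipE flip_pointK -!lowE => /connect1.
by apply/idP/idP => /homo //; rewrite !flipK !flip_stackK.
Qed.

Lemma compose_flip X Y : compose (flip Y) (flip X) = flip (compose X Y).
Proof.
apply: diagramP => p; apply: compose_connect; first exact: mate_neq.
have := connect_compose X Y (flip_point p).
by rewrite -connect_flip !flip_stack_outer flip_pointK flipE.
Qed.

Lemma loops_flip X Y : loops (flip Y) (flip X) = loops X Y.
Proof.
have adj : rel_adjunction flip_stack (stack X Y) (stack (flip Y) (flip X))
    (closed_part X Y).
  split=> [u _|u v _]; first by exists (flip_stack u); rewrite flip_stackK.
  by rewrite -(connect_flip X Y (flip_stack u)) !flip_stackK.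
rewrite [RHS]loopsE (adjunction_n_comp _ _ _ _ adj);
  try exact: stack_connect_sym; last exact: closed_part_closed.
rewrite loopsE; apply: eq_n_comp_r => u; rewrite !inE.
have E p : connect (stack (flip Y) (flip X)) u (outer p) =
    connect (stack X Y) (flip_stack u) (outer (flip_point p)).
  by rewrite -(connect_flip X Y) flip_stackK flip_stack_outer flip_pointK.
by apply/forallP/forallP => h p; move: (h (flip_point p));
  rewrite E ?flip_pointK.
Qed.

Lemma leq_through_flip X : (through X <= through (flip X))%N.
Proof.
pose g i := if X (inl i) is inr k then k else i.
rewrite /through -(@card_in_imset _ _ g); last first.
  move=> i j; rewrite !inE /g; case Ei: (X (inl i)) => [//|k] _.
  case Ej: (X (inl j)) => [//|l] _ kl; apply/inl_inj/(inv_inj (mateK X)).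
  by rewrite Ei Ej kl.
apply/subset_leq_card/subsetP => _ /imsetP[i + ->]; rewrite !inE /g.
by case Ei: (X (inl i)) => [//|k] _; rewrite flipE /= -Ei mateK.
Qed.

Lemma through_flip X : through (flip X) = through X.
Proof.
by apply/eqP; rewrite eqn_leq leq_through_flip -{2}[X]flipK leq_through_flip.
Qed.

End Flip.

Section PermDiagrams.

Variable n : nat.
Implicit Types (X Y : diagram n) (p : point n) (s t : 'S_n).

Definition top_act s p : point n :=
  match p with inl k => inl (s k) | inr k => inr k end.

Lemma top_act_inj s : injective (top_act s).
Proof. by move=> [i|i] [j|j] //= [] /perm_inj ->. Qed.

Definition top_perm s : {perm point n} := perm (top_act_inj (s := s)).

Lemma top_permE s p : top_perm s p = top_act s p. Proof. exact: permE. Qed.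

Lemma top_permM s t : top_perm (s * t) = (top_perm s * top_perm t)%g.
Proof. by apply/permP => -[k|k]; rewrite permM !top_permE //= permM. Qed.

Lemma top_perm1 : top_perm 1 = 1%g.
Proof. by apply/permP => -[k|k]; rewrite !top_permE perm1 //= perm1. Qed.

Lemma top_permV s : ((top_perm s)^-1 = top_perm s^-1)%g.
Proof. by apply/eqP; rewrite eq_invg_mul -top_permM mulgV top_perm1. Qed.

Lemma top_perm_tperm i j : top_perm (tperm i j) = tperm (inl i) (inl j).
Proof.
have inl_inj' : injective (@inl 'I_n 'I_n) by move=> ? ? [].
apply/permP => -[k|k]; rewrite top_permE /=; last by rewrite tpermD.
by rewrite !permE /= !(inj_eq inl_inj') !(fun_if inl).
Qed.

Lemma relabel_topE s X p :
  relabel (top_perm s) X p = top_act s^-1 (X (top_act s p)).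
Proof. by rewrite relabelE top_permV !top_permE. Qed.

Lemma through_relabel_top s X : through (relabel (top_perm s) X) = through X.
Proof.
rewrite /through -[RHS](card_preimset _ (@perm_inj _ s)); apply: eq_card => i.
by rewrite !inE relabel_topE /=; case: (X _).
Qed.

Lemma perm_diagram_subproof s : is_matching
  [ffun p : point n => match p : point n with
     inl k => inr (s k) | inr k => inl ((s^-1)%g k) end].
Proof. by apply/forallP => -[k|k]; rewrite !ffunE /= ?permK ?permKV. Qed.

Definition perm_diagram s := Diagram (perm_diagram_subproof s).

Lemma perm_diagram_inl s k : perm_diagram s (inl k) = inr (s k).
Proof. by rewrite ffunE. Qed.

Lemma perm_diagram_inr s k : perm_diagram s (inr k) = inl ((s^-1)%g k).
Proof. by rewrite ffunE. Qed.

Lemma perm_diagram_inj : injective perm_diagram.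
Proof.
move=> s t st; apply/permP => k.
have := perm_diagram_inl s k; rewrite st perm_diagram_inl.
by case.
Qed.

Lemma through_perm_diagram s : through (perm_diagram s) = n.
Proof.
rewrite -[RHS]card_ord; apply: eq_card => k.
by rewrite !inE perm_diagram_inl.
Qed.

Lemma through_lt X i j : X (inr i) = inr j -> (through X < n)%N.
Proof.
move=> Xij; rewrite -through_flip -[X in (_ < X)%N]card_ord.
rewrite -cardsT proper_card //; apply/properP; split; first exact: subsetT.
by exists i; rewrite !inE // flipE /= Xij.
Qed.

Lemma perm_or_bottom_arc X :
  (exists s, X = perm_diagram s) \/ (exists i j, X (inr i) = inr j).
Proof.
case: (boolP [exists i, exists j, X (inr i) == inr j]) => [|/existsPn h].
  by case/existsP=> i /existsP[j /eqP]; right; exists i, j.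
left; have {}h i j : X (inr i) != inr j.
  by apply: contra (h i) => ij; apply/existsP; exists j.
pose g i := if X (inr i) is inl k then k else i.
have gE i : X (inr i) = inl (g i).
  by rewrite /g; case E: (X (inr i)) (h i) => [//|k] /(_ k); rewrite eqxx.
have gI : injective g.
  by move=> i j gij; have := mateK X (inr i); rewrite gE gij -gE mateK => -[].
exists (perm gI)^-1%g; apply: diagramP => -[k|k]; last first.
  by rewrite perm_diagram_inr invgK permE gE.
rewrite perm_diagram_inl; apply/eqP; rewrite mate_eq gE.
by rewrite -(permE gI) permKV.
Qed.

Lemma connect_perm_diagram s Y p :
  connect (stack (perm_diagram s) Y) (outer p) (lower (top_act s p)).
Proof.
case: p => k; last exact: connect0.
apply: connect1; rewrite -[lower _]/(inl (inr (s k))) -perm_diagram_inl.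
exact: stack_upper.
Qed.

Lemma compose_perm_diagram s Y :
  compose (perm_diagram s) Y = relabel (top_perm s) Y.
Proof.
apply: diagramP => p; apply: compose_connect; first exact: mate_neq.
apply: connect_trans (connect_perm_diagram s Y p) _.
have := connect_perm_diagram s Y (relabel (top_perm s) Y p).
rewrite relabel_topE -!top_permE -top_permV permKV stack_connect_sym.
by apply: connect_trans; apply: connect1; exact: stack_lower.
Qed.

Lemma loops_perm_diagram s Y : loops (perm_diagram s) Y = 0%N.
Proof.
apply: loops_eq0 => -[[k|k]|k].
- by exists (inl k); exact: connect0.
- exists (inl ((s^-1)%g k)); rewrite stack_connect_sym.
  by have := connect_perm_diagram s Y (inl ((s^-1)%g k)); rewrite /= permKV.
- by exists (inr k); exact: connect0.
Qed.

Lemma card_through_n : #|[set X : diagram n | through X == n]| = n`!.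
Proof.
have -> : [set X | through X == n] = [set perm_diagram s | s in 'S_n].
  apply/setP => X; rewrite inE; apply/eqP/imsetP => [Xn|[s _ ->]].
    have [[s ->]|[i [j Xij]]] := perm_or_bottom_arc X; first by exists s.
    by have := through_lt Xij; rewrite Xn ltnn.
  exact: through_perm_diagram.
by rewrite card_imset ?card_Sn //; exact: perm_diagram_inj.
Qed.

End PermDiagrams.

Section Generators.

Variables (n : nat) (i : 'I_n.-1).

Lemma v_diagramE : v_diagram i = perm_diagram (tperm (here i) (Defs.next i)).
Proof.
apply: diagramP => -[k|k]; first by rewrite perm_diagram_inl ffunE.
by rewrite perm_diagram_inr tpermV ffunE.
Qed.

Lemma flip_v_diagram : flip (v_diagram i) = v_diagram i.
Proof. by apply: diagramP => -[k|k]; rewrite flipE !ffunE. Qed.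

Lemma flip_e_diagram : flip (e_diagram i) = e_diagram i.
Proof.
by apply: diagramP => -[k|k]; rewrite flipE !ffunE /=; case: ifP.
Qed.

Lemma e_diagram_top : e_diagram i (inl (here i)) = inl (Defs.next i).
Proof. by rewrite ffunE mem_head /swap tpermL. Qed.

Lemma e_diagram_bottom : e_diagram i (inr (here i)) = inr (Defs.next i).
Proof. by rewrite ffunE mem_head /swap tpermL. Qed.

Lemma e_diagram_vertical k : k != here i -> k != Defs.next i ->
  e_diagram i (inl k) = inr k.
Proof. by move=> kh kn; rewrite ffunE !inE (negPf kh) (negPf kn). Qed.

Lemma compose_e_diagram (Y : diagram n) :
  Y (inl (here i)) = inl (Defs.next i) -> compose (e_diagram i) Y = Y.
Proof.
move=> Yhn; apply: diagramP => p; apply: compose_connect => //.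
  exact: mate_neq.
have hn : connect (stack (e_diagram i) Y) (outer (inl (here i)))
    (outer (inl (Defs.next i))).
  apply: connect1; rewrite /outer -e_diagram_top; exact: stack_upper.
have Ynh : Y (inl (Defs.next i)) = inl (here i) by rewrite -Yhn mateK.
have [->|ph] := eqVneq p (inl (here i)); first by rewrite Yhn.
have [->|pn] := eqVneq p (inl (Defs.next i)).
  by rewrite Ynh stack_connect_sym.
have vert q : q != inl (here i) -> q != inl (Defs.next i) ->
    connect (stack (e_diagram i) Y) (outer q) (lower q).
  case: q => k kh kn; last exact: connect0.
  apply: connect1; rewrite /= -(@e_diagram_vertical k) //.
  exact: stack_upper.
apply: connect_trans (vert p ph pn) _.
apply: connect_trans (connect1 (stack_lower _ _ _)) _.
by rewrite stack_connect_sym vert // mate_eq ?Yhn ?Ynh.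
Qed.

End Generators.

Lemma adjacent_tperm_ind n (P : 'S_n -> Prop) :
  P 1%g -> (forall s t, P s -> P t -> P (s * t)%g) ->
  (forall i : 'I_n.-1, P (tperm (here i) (Defs.next i))) -> forall s, P s.
Proof.
move=> P1 PM Padj.
have Plt m (a b : 'I_n) : (b = a + m.+1 :> nat)%N -> P (tperm a b).
  elim: m b => [|m IH] b ab.
    have an : (a < n.-1)%N.
      by rewrite ltn_predRL; move: (ltn_ord b); rewrite ab addn1.
    have <- : here (Ordinal an) = a by exact: val_inj.
    have <- // : Defs.next (Ordinal an) = b.
    by apply: val_inj; rewrite /= ab addn1.
  have bn : (a + m.+1 < n.-1)%N.
    by rewrite ltn_predRL -addnS -ab; exact: ltn_ord.
  pose i := Ordinal bn; have ib : Defs.next i = b.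
    by apply: val_inj; rewrite /= ab !addnS.
  have Pi := Padj i; rewrite ib in Pi.
  have -> : tperm a b = (tperm a (here i) ^ tperm (here i) b)%g.
    rewrite tpermJ tpermL tpermD // -val_eqE /=.
      by rewrite -[X in _ != X]addn0 eqn_add2l.
    by rewrite ab -[X in _ != X]addn0 eqn_add2l.
  by rewrite conjgE tpermV; apply: (PM) => //; apply: (PM) => //; apply: IH.
have Pt a b : P (tperm a b).
  have [ab|ba|/val_inj->] := ltngtP a b; last by rewrite tperm1.
    by apply: (Plt (b - a.+1)%N); rewrite addnS -addSn subnKC.
  by rewrite tpermC; apply: (Plt (a - b.+1)%N); rewrite addnS -addSn subnKC.
move=> s; have [ts -> _] := prod_tpermP s.
by apply: (big_ind P) => // t _; exact: Pt.
Qed.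

Section Absorption.

Variables (K : fieldType) (d : K) (n : nat).
Implicit Types (f g : VTL K n) (X Y Z : diagram n) (s : 'S_n).

Lemma basis_vmulE X f : vmul d (basis K X) f =
  \sum_Y (f Y * d ^+ loops X Y) *: basis K (compose X Y).
Proof.
rewrite /vmul (bigD1 X) //= [X in _ + X]big1 ?addr0 => [|Z ZX].
  by apply: eq_bigr => Y _; rewrite ffunE eqxx mul1r.
by apply: big1 => Y _; rewrite ffunE (negPf ZX) !mul0r scale0r.
Qed.

Lemma vmulEl f g : vmul d f g = \sum_X f X *: vmul d (basis K X) g.
Proof.
apply: eq_bigr => X _; rewrite basis_vmulE scaler_sumr.
by apply: eq_bigr => Y _; rewrite scalerA mulrA.
Qed.

Definition flip_elt f : VTL K n := [ffun X => f (flip X)].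

Lemma flip_eltK : involutive flip_elt.
Proof. by move=> f; apply/ffunP => X; rewrite !ffunE flipK. Qed.

Lemma flip_elt_basis X : flip_elt (basis K X) = basis K (flip X).
Proof. by apply/ffunP => Y; rewrite !ffunE (inv_eq (@flipK n)). Qed.

Lemma flip_elt0 : flip_elt 0 = 0.
Proof. by apply/ffunP => Y; rewrite !ffunE. Qed.

Lemma flip_eltZ (a : K) f : flip_elt (a *: f) = a *: flip_elt f.
Proof. by apply/ffunP => Y; rewrite !ffunE. Qed.

Lemma vmul_flip f g : vmul d (flip_elt f) (flip_elt g) = flip_elt (vmul d g f).
Proof.
apply/ffunP => Z; rewrite ffunE /vmul !sum_ffunE.
rewrite (reindex_inj (inv_inj (@flipK n))) /=.
under eq_bigr do rewrite sum_ffunE (reindex_inj (inv_inj (@flipK n))) /=.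
under [RHS]eq_bigr do rewrite sum_ffunE.
rewrite exchange_big /=; apply: eq_bigr => X _; apply: eq_bigr => Y _.
rewrite !ffunE !flipK loops_flip compose_flip -(inv_eq (@flipK n)).
by rewrite [f Y * _]mulrC.
Qed.

Definition augmentation f : K := \sum_(X : diagram n | through X == n) f X.

Definition absorbing f :=
  forall X, vmul d (basis K X) f = (through X == n)%:R *: f.

Lemma absorbing_vmul f g : absorbing g -> vmul d f g = augmentation f *: g.
Proof.
move=> ag; rewrite vmulEl /augmentation scaler_suml [RHS]big_mkcond.
apply: eq_bigr => X _; rewrite ag scalerA; case: eqP => _.
  by rewrite mulr1.
by rewrite mulr0 scale0r.
Qed.

Lemma augmentation_flip f : augmentation (flip_elt f) = augmentation f.
Proof.
rewrite /augmentation (reindex_inj (inv_inj (@flipK n))) /=.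
by apply: eq_big => X; rewrite ?through_flip // ffunE flipK.
Qed.

Lemma vmul_absorbing f g : absorbing (flip_elt f) ->
  vmul d f g = augmentation g *: f.
Proof.
move=> af; apply: (inv_inj flip_eltK); rewrite -vmul_flip absorbing_vmul //.
by rewrite augmentation_flip flip_eltZ.
Qed.

Definition top_invariant f :=
  forall s Y, f (relabel (top_perm s) Y) = f Y.

Lemma perm_vmulE s f Z : vmul d (basis K (perm_diagram s)) f Z =
  f (relabel (top_perm s^-1) Z).
Proof.
rewrite basis_vmulE sum_ffunE (bigD1 (relabel (top_perm s^-1) Z)) //=.
rewrite big1 ?addr0 => [|Y YZ]; rewrite !ffunE /= compose_perm_diagram.
  rewrite loops_perm_diagram -relabelM -top_permM mulgV top_perm1 relabel1.
  by rewrite eqxx mulr1; exact: mulr1.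
rewrite loops_perm_diagram; case: eqP => [ZE|_]; last by exact: mulr0.
by rewrite ZE -relabelM -top_permM mulVg top_perm1 relabel1 eqxx in YZ.
Qed.

(* The sum of the coefficients of [f] at the diagrams that become [Y] when
   the points [inl i] and [inl j] are capped off, for [Y (inl i) = inl j]. *)
Definition capped_coef f (i j : 'I_n) Y : K :=
  d * f Y + \sum_(p | (p != inl i) && (p != inl j))
               f (relabel (tperm (inl j) p) Y).

Lemma bottom_arc_vmulE X i j f : X (inr i) = inr j ->
  vmul d (basis K X) f =
  \sum_(Y : diagram n | Y (inl i) == inl j)
     (d ^+ (loops X Y).-1 * capped_coef f i j Y) *: basis K (compose X Y).
Proof.
move=> Xij; have ij : i != j.
  by have := mate_neq X (inr i); rewrite Xij eq_sym; apply: contraNneq => ->.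
rewrite basis_vmulE.
rewrite (partition_big (fun Y : diagram n => Y (inl i)) (fun p => p != inl i));
  last by move=> Y _; exact: mate_neq.
have ji : inl j != inl i :> point n.
  by rewrite eq_sym; apply: contraNneq ij => -[->].
rewrite (bigD1 (inl j)) //=.
under [X in _ + X]eq_bigr => p /andP[pi pj].
  rewrite (reindex_inj (inv_inj (relabel_tpermK (inl j) p))).
  under eq_bigl => Y.
    rewrite relabelE tpermV (tpermD (z := inl i)) //.
    rewrite -(inj_eq (@perm_inj _ (tperm (inl j) p))) tpermK tpermR.
    over.
  over.
rewrite /= exchange_big -big_split /=; apply: eq_bigr => Y /eqP Yij.
have open p : p != inl i -> p != inl j ->
    loops X (relabel (tperm (inl j) p) Y) = (loops X Y).-1 /\
    compose X (relabel (tperm (inl j) p) Y) = compose X Y.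
  move=> pi pj; rewrite (compose_open_loop Xij Yij pi pj).
  by rewrite (loops_open_loop Xij Yij pi pj).
have loop : loops X Y = (loops X Y).-1.+1.
  by rewrite (loops_open_loop Xij Yij (p := inr i)).
rewrite [X in _ + X](eq_bigr (fun p =>
  (f (relabel (tperm (inl j) p) Y) * d ^+ (loops X Y).-1) *:
    basis K (compose X Y))); last first.
  by move=> p /andP[pi pj]; have [-> ->] := open p pi pj.
rewrite -scaler_suml -scalerDl; congr (_ *: _).
rewrite {1}loop exprS /capped_coef mulrDr mulr_sumr; congr (_ + _).
  by rewrite mulrC -mulrA mulrCA.
by apply: eq_bigr => p _; rewrite mulrC.
Qed.

Lemma capped_absorbing f : top_invariant f ->
  (forall i j Y, Y (inl i) = inl j -> capped_coef f i j Y = 0) -> absorbing f.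
Proof.
move=> inv cap X; have [[s ->]|[i [j Xij]]] := perm_or_bottom_arc X.
  rewrite through_perm_diagram eqxx scale1r; apply/ffunP => Z.
  by rewrite perm_vmulE inv.
rewrite (bottom_arc_vmulE _ Xij) big1 => [|Y /eqP Yij].
  by rewrite (ltn_eqF (through_lt Xij)) scale0r.
by rewrite cap // mulr0 scale0r.
Qed.

Lemma capped_coef_relabel f s i j Y : top_invariant f ->
  capped_coef f i j (relabel (top_perm s) Y) = capped_coef f (s i) (s j) Y.
Proof.
move=> inv; rewrite /capped_coef inv; congr (_ + _).
rewrite [RHS](reindex_inj (@perm_inj _ (top_perm s))) /=.
have E k : inl (s k) = top_perm s (inl k) by rewrite top_permE.
apply: eq_big => [p|p _]; first by rewrite !E !(inj_eq perm_inj).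
by rewrite -relabelM conjgC tpermJ -E relabelM inv.
Qed.

Lemma absorbing_generators f : d != 0 ->
  (forall i : 'I_n.-1, vmul d (e_ K i) f = 0 /\ vmul d (v_ K i) f = f) ->
  absorbing f.
Proof.
move=> d0 gen; have inv : top_invariant f.
  apply: (adjacent_tperm_ind (P := fun s =>
    forall Y, f (relabel (top_perm s) Y) = f Y)) => [Y|s t IHs IHt Y|i Y].
  - by rewrite top_perm1 relabel1.
  - by rewrite top_permM relabelM IHs IHt.
  - have [_ {2}<-] := gen i.
    by rewrite /v_ v_diagramE perm_vmulE tpermV.
apply: capped_absorbing => // i j Y Yij.
have ij : i != j.
  by have := mate_neq Y (inl i); rewrite Yij eq_sym; apply: contraNneq => ->.
have n1 : (0 < n.-1)%N.
  rewrite ltn_predRL; case: (n) i j ij {Y Yij} => [[]//|[|//]] i j.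
  by rewrite !ord1.
pose k := Ordinal n1; pose t := tperm (here k) i.
pose s := (t * tperm (t (Defs.next k)) j)%g.
have si : s (here k) = i.
  rewrite permM /t tpermL tpermD // 1?eq_sym //.
  rewrite -[X in X != _](tpermL (here k)) (inj_eq perm_inj).
  exact: here_neq_next.
have sj : s (Defs.next k) = j by rewrite permM tpermL.
rewrite -{1}si -{1}sj -capped_coef_relabel //.
set Z := relabel _ Y; have Zk : Z (inl (here k)) = inl (Defs.next k).
  by rewrite /Z relabel_topE /= si Yij /= -sj permK.
have [/ffunP/(_ Z) + _] := gen k.
rewrite /e_ (bottom_arc_vmulE _ (e_diagram_bottom k)) sum_ffunE.
rewrite (bigD1 Z) /=; last by apply/eqP.
rewrite big1 => [|Y' /andP[/eqP Y'k /negPf Y'Z]]; last first.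
  rewrite !ffunE /= compose_e_diagram // eq_sym Y'Z; exact: mulr0.
rewrite !ffunE /= compose_e_diagram // eqxx addr0.
rewrite [_ *: _]mulr1 => /eqP; rewrite mulf_eq0 expf_eq0 (negPf d0) andbF.
by move/eqP.
Qed.

End Absorption.

Section ThroughExchange.

Variables (n : nat) (Y : diagram n) (i j : 'I_n).
Hypothesis Yij : Y (inl i) = inl j.

Let Yji : Y (inl j) = inl i. Proof. by rewrite -Yij mateK. Qed.

Lemma top_arc_neq : i != j.
Proof.
by have := mate_neq Y (inl i); rewrite Yij eq_sym; apply: contraNneq => ->.
Qed.

Lemma through_exchange_top k :
  through (relabel (tperm (inl j) (inl k)) Y) = through Y.
Proof. by rewrite -top_perm_tperm through_relabel_top. Qed.

Lemma through_exchange_through k l : Y (inr k) = inl l ->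
  through (relabel (tperm (inl j) (inr k)) Y) = through Y.
Proof.
move=> Ykl; have Ylk : Y (inl l) = inr k by rewrite -Ykl mateK.
have lS : l \in [set m | if Y (inl m) is inr _ then true else false].
  by rewrite inE Ylk.
have li : l != i by apply/eqP => li; rewrite li Yij in Ylk.
have lj : l != j by apply/eqP => lj; rewrite lj Yji in Ylk.
have Zl : relabel (tperm (inl j) (inr k)) Y (inl l) = inl j.
  by rewrite -Ykl -(exchange_snd Yij (r := inr k)) // mateK.
rewrite /through [RHS](cardsD1 l) lS /=.
set S := _ :\ l; have iS : i \notin S by rewrite !inE Yij andbF.
have -> : (1 + #|S|)%N = #|i |: S| by rewrite cardsU1 iS.
apply: eq_card => m; rewrite !inE.
have [->|mi] := eqVneq m i; first by rewrite (exchange_fst Yij).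
have [->|mj] := eqVneq m j.
  by rewrite (exchange_snd Yij) // Ykl Yji andbF.
have [->|ml] := eqVneq m l.
  by rewrite Zl.
have inlE a b : (inl a == inl b :> point n) = (a == b) by [].
by rewrite (exchangeD Yij) ?Ykl ?inlE.
Qed.

Lemma through_exchange_bottom k l : Y (inr k) = inr l ->
  through (relabel (tperm (inl j) (inr k)) Y) = (through Y).+2.
Proof.
move=> Ykl; rewrite /through.
set S := [set m | if Y (inl m) is inr _ then true else false].
have iS : i \notin j |: S by rewrite !inE Yij orbF top_arc_neq.
have jS : j \notin S by rewrite !inE Yji.
have -> : #|S|.+2 = #|i |: (j |: S)| by rewrite !cardsU1 iS jS.
apply: eq_card => m; rewrite !inE.
have [->|mi] := eqVneq m i; first by rewrite (exchange_fst Yij).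
have [->|mj] := eqVneq m j; first by rewrite (exchange_snd Yij) // Ykl.
have inlE a b : (inl a == inl b :> point n) = (a == b) by [].
by rewrite (exchangeD Yij) ?Ykl ?inlE.
Qed.

End ThroughExchange.

Lemma through_le n (X : diagram n) : (through X <= n)%N.
Proof. by rewrite -[X in (_ <= X)%N]card_ord max_card. Qed.

Section Projector.

Variables (K : fieldType) (d : K) (n : nat).

Definition projector_coef (l : nat) : K :=
  (- 2) ^+ l * l`!%:R /
    (n`!%:R * \prod_(1 <= i < l.+1) (d + 2 * n%:R - 2 - 2 * i%:R)).

Definition projector_sum : VTL K n :=
  \sum_(0 <= l < n./2.+1) projector_coef l *: k_elements_sum K n (n - 2 * l).

Definition through_coef (k : nat) : K :=
  if odd (n + k) then 0 else projector_coef (n - k)./2.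

Lemma k_elements_sumE k X : k_elements_sum K n k X = (through X == k)%:R.
Proof.
rewrite /k_elements_sum sum_ffunE; have [Xk|/eqP Xk] := eqVneq.
  rewrite (bigD1 X) ?Xk //= big1 ?addr0 ?ffunE ?eqxx // => Y /andP[_ YX].
  by rewrite ffunE eq_sym (negPf YX).
rewrite big1 // => Y /eqP Yk; rewrite ffunE; case: eqP => // XY.
by rewrite XY in Xk.
Qed.

Lemma projector_sumE X : projector_sum X = through_coef (through X).
Proof.
have Xn := through_le X; set k := through X in Xn *.
have nk : (n = k + (n - k))%N by rewrite subnKC.
have E l : (projector_coef l *: k_elements_sum K n (n - 2 * l)) X =
    projector_coef l * (k == n - 2 * l)%N%:R.
  by rewrite ffunE k_elements_sumE.
rewrite /projector_sum sum_ffunE; under eq_bigr do rewrite E.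
rewrite /through_coef oddD -oddB //; case: ifPn => [odd_nk|even_nk].
  rewrite big_nat big1 // => l /andP[_ ln]; case: eqP => [kl|]; last first.
    by rewrite mulr0.
  move: odd_nk; rewrite kl subKn ?oddM //.
  by rewrite mul2n -geq_half_double -ltnS.
have := odd_double_half (n - k); rewrite (negPf even_nk) add0n => lE.
set l := (n - k)./2 in lE *.
have ln : (l < n./2.+1)%N by rewrite ltnS half_leq // leq_subr.
rewrite big_mkord (bigD1 (Ordinal ln)) //= big1 => [|m ml].
  by rewrite addr0 mul2n lE subKn // eqxx mulr1.
case: eqP => [km|]; last by rewrite mulr0.
case/eqP: ml; apply: val_inj => /=; apply: double_inj; rewrite lE km.
by rewrite mul2n subKn // -geq_half_double -ltnS.
Qed.

Hypothesis factn0 : n`!%:R != 0 :> K.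
Hypothesis d0 : d != 0.
Hypothesis den0 : forall l : nat, (0 < l)%N ->
  d + 2 * n%:R - 2 - 2 * l%:R != 0.

Lemma projector_coefS l :
  (d + 2 * n%:R - 2 - 2 * l.+1%:R) * projector_coef l.+1 +
  2 * l.+1%:R * projector_coef l = 0.
Proof.
have prod0 m : \prod_(1 <= i < m.+1) (d + 2 * n%:R - 2 - 2 * i%:R) != 0.
  rewrite prodf_seq_neq0; apply/allP => i; rewrite mem_index_iota.
  move=> /andP[i0 _].
  exact: den0.
rewrite /projector_coef big_nat_recr //= factS natrM exprS.
set c := d + _ - _ - _; set P := \prod_(_ <= i < _) _.
have c0 : c != 0 by exact: den0.
have P0 : P != 0 by exact: prod0.
by field; rewrite c0 P0 factn0.
Qed.

Lemma through_coef_rec (k : nat) : (k < n)%N ->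
  (d + 2 * n%:R - 2 - (n - k)%:R) * through_coef k +
  (n - k)%:R * through_coef k.+2 = 0.
Proof.
move=> kn; rewrite /through_coef !addnS /= negbK.
case: ifPn => [_|]; first by rewrite !mulr0 addr0.
rewrite oddD -oddB ?(ltnW kn) // => even_nk.
have := odd_double_half (n - k); rewrite (negPf even_nk) add0n.
case E : (n - k)./2 => [|l] lE.
  by rewrite -subn_gt0 -lE in kn.
have -> : (n - k.+2)./2 = l.
  by rewrite -(doubleK l) -addn2 subnDA -lE doubleS subn2.
by rewrite -lE -mul2n natrM projector_coefS.
Qed.

Lemma capped_projector_sum i j (Y : diagram n) :
  Y (inl i) = inl j -> capped_coef d projector_sum i j Y = 0.
Proof.
move=> Yij; have ij := top_arc_neq Yij; rewrite /capped_coef big_sumType /=.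
set k := through Y.
have kn : (k < n)%N.
  rewrite -[X in (_ < X)%N]card_ord -cardsT proper_card //.
  apply/properP; split; first exact: subsetT.
  by exists i; rewrite !inE // Yij.
rewrite (eq_bigr (fun=> through_coef k)) => [|l _]; last first.
  by rewrite projector_sumE through_exchange_top.
rewrite sumr_const [X in _ + (_ + X)](eq_bigr (fun l => if Y (inr l) is inl _
   then through_coef k else through_coef k.+2)); last first.
  move=> l _; rewrite projector_sumE; case Yl: (Y (inr l)) => [m|m].
    by rewrite (through_exchange_through Yij Yl).
  by rewrite (through_exchange_bottom Yij Yl).
rewrite (bigID (fun l => if Y (inr l) is inl _ then true else false)) /=.
rewrite (eq_bigr (fun=> through_coef k)) => [|l]; last by case: (Y (inr l)).
rewrite sumr_const [X in _ + (_ + (_ + X))](eq_bigr (fun=> through_coef k.+2));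
  last by move=> l; case: (Y (inr l)).
rewrite sumr_const projector_sumE.
have c1 : #|[pred l |
    (inl l != inl i :> point n) && (inl l != inl j :> point n)]| = (n - 2)%N.
  have <- : #|~: [set i; j]| = (n - 2)%N.
    by rewrite cardsCs setCK card_ord cards2 ij.
  by apply: eq_card => l; rewrite !inE negb_or.
have c2 : #|[pred l : 'I_n | if Y (inr l) is inl _ then true else false]| = k.
  rewrite /k -through_flip; apply: eq_card => l.
  by rewrite !inE flipE /=; case: (Y (inr l)).
have c3 : #|[pred l : 'I_n | ~~ (if Y (inr l) is inl _ then true else false)]|
    = (n - k)%N.
  apply: (@addnI k); rewrite subnKC ?(ltnW kn) // -{1}c2 -[RHS]card_ord.
  exact: cardC.
have n2 : (2 <= n)%N.
  by case: (n) i j ij {Yij c1} => [[]//|[|//]] a b; rewrite !ord1.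
have := through_coef_rec kn.
rewrite c1 c2 c3 -/k !natrB ?(ltnW kn) // => rec.
rewrite -[RHS]rec -!(mulr_natl (through_coef _)) !natrB ?(ltnW kn) //; ring.
Qed.

Lemma projector_sum_flip : flip_elt projector_sum = projector_sum.
Proof. by apply/ffunP => X; rewrite ffunE !projector_sumE through_flip. Qed.

Lemma absorbing_projector_sum : absorbing d projector_sum.
Proof.
apply: capped_absorbing => [s Y|]; last exact: capped_projector_sum.
by rewrite !projector_sumE through_relabel_top.
Qed.

Lemma augmentation_projector_sum : augmentation projector_sum = 1.
Proof.
rewrite /augmentation (eq_bigr (fun=> projector_coef 0)) => [|X /eqP Xn].
  rewrite sumr_const; have -> : #|[pred X : diagram n | through X == n]| = n`!.
    by rewrite -card_through_n; apply: eq_card => X; rewrite !inE.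
  rewrite /projector_coef big_geq // expr0 fact0 mulr1 !mul1r.
  by rewrite -[LHS]mulr_natr mulVf.
by rewrite projector_sumE Xn /through_coef addnn odd_double subnn.
Qed.

Lemma is_projectorP f : is_projector d f <-> f = projector_sum.
Proof.
have flip_basis (X : diagram n) :
    flip X = X -> flip_elt (basis K X) = basis K X.
  by move=> XE; rewrite flip_elt_basis XE.
have absP := absorbing_projector_sum.
have absPr : absorbing d (flip_elt projector_sum) by rewrite projector_sum_flip.
split=> [[f0 ff gen]|->].
  have absf : absorbing d (flip_elt f).
    apply: absorbing_generators => // i; have [fe _ fv _] := gen i.
    rewrite /e_ /v_ -(flip_basis _ (flip_e_diagram i)).
    rewrite -(flip_basis _ (flip_v_diagram i)) !vmul_flip fe fv.
    by rewrite flip_elt0.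
  have fE : f = augmentation f *: projector_sum.
    rewrite -(absorbing_vmul f absP) (vmul_absorbing _ absf).
    by rewrite augmentation_projector_sum scale1r.
  have := vmul_absorbing f absf; rewrite ff => ffE.
  have : (augmentation f - 1) *: f == 0 by rewrite scalerBl -ffE scale1r subrr.
  rewrite scaler_eq0 (negPf f0) orbF subr_eq0 => /eqP f1.
  by rewrite fE f1 scale1r.
have P0 : projector_sum != 0.
  apply/eqP => P0; have := augmentation_projector_sum; rewrite P0.
  rewrite /augmentation big1 => [/eqP|X _]; last by rewrite ffunE.
  by rewrite eq_sym oner_eq0.
split=> // [|i].
  by rewrite (absorbing_vmul _ absP) augmentation_projector_sum scale1r.
have aug (X : diagram n) : augmentation (basis K X) = (through X == n)%:R.
  rewrite /augmentation big_mkcond (bigD1 X) //= big1 => [|Y YX].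
    by rewrite addr0 ffunE eqxx; case: eqP.
  by rewrite ffunE (negPf YX) if_same.
rewrite !(absorbing_vmul _ absP) !(vmul_absorbing _ absPr) !aug.
rewrite (ltn_eqF (through_lt (e_diagram_bottom i))) v_diagramE.
by rewrite through_perm_diagram eqxx scale0r scale1r.
Qed.

End Projector.

Lemma indeterminate_neq0 (R : realType) (a : R[i]) :
  indeterminate R + tofrac a%:P != 0.
Proof.
rewrite /indeterminate -tofracD tofrac_eq0 -size_poly_eq0 size_XaddC //.
Qed.

Theorem corollary5p5 (R : realType) (n : nat) (hn : (0 < n)%N) :
  let d := indeterminate R in
  forall f : VTL (rational_functions R) n,
    is_projector d f <->
    f = \sum_(0 <= l < n./2.+1)
          ((- 2) ^+ l * l`!%:R /
           (n`!%:R * \prod_(1 <= i < l.+1) (d + 2 * n%:R - 2 - 2 * i%:R)))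
          *: k_elements_sum (rational_functions R) n (n - 2 * l).
Proof.
move=> d f; apply: is_projectorP.
- rewrite -tofrac1 -tofracMn tofrac_eq0 -polyC1 -polyCMn polyC_eq0.
  by rewrite Num.Theory.pnatr_eq0 -lt0n fact_gt0.
- by have := @indeterminate_neq0 R 0; rewrite polyC0 tofrac0 addr0.
move=> l _; have := @indeterminate_neq0 R (2 * n%:R - 2 - 2 * l%:R).
rewrite !polyCB !polyCM !polyC_natr !tofracB !tofracM !tofracMn tofrac1.
by rewrite !addrA.
Qed.
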